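(* For every integer $k\ge 1$, every $k$-connected graph $G$ with $\delta(G)\ge 2k+1$ contains a $k$-removable $\bigl\lceil(\delta(G)+1)/2\bigr\rceil$-matching, unless $\delta(G)$ is even and $G\cong K_{\delta(G)+1}$.
   Context: All graphs are finite, undirected and simple. $\delta(G)$ denotes the minimum degree of $G$, and $K_n$ is the complete graph on $n$ vertices. A graph is $k$-connected if it has at least $k+1$ vertices and deleting any set of at most $k-1$ vertices leaves a connected graph. For $F\subseteq E(G)$, $G-F$ is the graph obtained from $G$ by deleting the edges in $F$ (keeping all vertices). A matching is a set of pairwise disjoint edges; an $\ell$-matching is a matching consisting of exactly $\ell$ edges. A matching $M$ of a $k$-connected graph $G$ is $k$-removable if $G-M$ is $k$-connected. *)

(* Defs.v *)
From mathcomp Require Import all_boot.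

Set Implicit Arguments.
Unset Strict Implicit.
Unset Printing Implicit Defensive.

(* A simple graph on the finite vertex type T is a symmetric irreflexive
   adjacency relation e : rel T; its edges are the two-element sets [set x; y]
   with e x y. *)
Definition simple_graph (T : finType) (e : rel T) : Prop :=
  symmetric e /\ irreflexive e.

Definition edges (T : finType) (e : rel T) : {set {set T}} :=
  [set [set x; y] | x in T, y in T & e x y].

Definition degree (T : finType) (e : rel T) (x : T) : nat :=
  #|[set y | e x y]|.

(* The neutral value #|T| exceeds every degree in a simple graph, so for
   nonempty T this is the least degree; for empty T it is 0. *)
Definition min_degree (T : finType) (e : rel T) : nat :=
  \big[minn/#|T|]_(x : T) degree e x.

Definition complete_graph (n : nat) : rel 'I_n := [rel x y | x != y].
Arguments complete_graph : clear implicits.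

Definition graph_iso (T1 T2 : finType) (e1 : rel T1) (e2 : rel T2) : Prop :=
  exists f : T1 -> T2, bijective f /\ forall x y, e2 (f x) (f y) = e1 x y.

Definition connected (T : finType) (e : rel T) : Prop :=
  forall x y : T, connect e x y.

Definition del_vertices (T : finType) (e : rel T) (S : {set T}) :
  rel {x : T | x \notin S} := relpre val e.
Arguments del_vertices {T} e S.

Definition del_edges (T : finType) (e : rel T) (F : {set {set T}}) : rel T :=
  [rel x y | e x y && ([set x; y] \notin F)].

(* The first conjunct guarantees that some vertex survives each deletion, so
   the convention on connectedness of the empty graph plays no role. *)
Definition k_connected (k : nat) (T : finType) (e : rel T) : Prop :=
  k.+1 <= #|T| /\ forall S : {set T}, #|S| < k -> connected (del_vertices e S).

Definition matching (T : finType) (e : rel T) (M : {set {set T}}) : Prop :=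
  M \subset edges e /\ trivIset M.

Definition l_matching (l : nat) (T : finType) (e : rel T)
  (M : {set {set T}}) : Prop := matching e M /\ #|M| = l.

Definition k_removable (k : nat) (T : finType) (e : rel T)
  (M : {set {set T}}) : Prop := k_connected k (del_edges e M).

(* Main.v *)
Require Import Defs.
From mathcomp Require Import all_boot.
From mathcomp Require Import zify.

(* Write d for the minimum degree. A k-removable matching M with 2|M| <= d is
   enlarged by one edge, unless G = K_(d+1) with d even. Let H = G - M and call
   a separation (A, B) of H tight if exactly k vertices lie outside A and B.
   - If H has a tight separation, both of its sides contain inclusion-minimal
     tight sides A1, A2. By uncrossing, deleting an edge inside such an Ai keeps
     H k-connected; if no such edge avoids M, a degree count shows that M covers
     at least d - k vertices of Ai, so 2|M| >= 2(d - k) > d.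
   - Otherwise every single edge of H can be deleted. If none avoids M, every
     uncovered vertex is adjacent to exactly the covered ones and 2|M| = d. When
     G is not K_(d+1) there are two uncovered vertices w1, w2, and some xy in M
     can be exchanged for w1 x and w2 y. *)

Set Implicit Arguments.
Unset Strict Implicit.
Unset Printing Implicit Defensive.

(** * Separations and connectivity *)

Section Separations.

Variable T : finType.
Implicit Types (e : rel T) (A B C D : {set T}) (k : nat).

Definition separation e A B :=
  [&& A != set0, B != set0, [disjoint A & B]
    & [forall x in A, forall y in B, ~~ e x y]].

Lemma separationP e A B :
  reflect [/\ A != set0, B != set0, forall x, x \in A -> x \in B -> False
            & forall x y, x \in A -> y \in B -> ~~ e x y]
          (separation e A B).
Proof.
apply: (iffP and4P) => -[A0 B0 dAB noe]; split=> //.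
- by move=> x xA xB; move/disjointFr: dAB => /(_ x xA); rewrite xB.
- move=> x y xA yB.
  by move/forallP: noe => /(_ x)/implyP/(_ xA)/forallP/(_ y)/implyP/(_ yB).
- by apply/pred0P=> x; apply/negP=> /andP[]; apply: dAB.
- apply/forallP=> x; apply/implyP=> xA.
  by apply/forallP=> y; apply/implyP=> yB; apply: noe.
Qed.

Lemma separation_sym e A B :
  symmetric e -> separation e A B -> separation e B A.
Proof.
move=> es /separationP[A0 B0 dAB noe]; apply/separationP; split=> //.
  by move=> x xB xA; apply: (dAB x).
by move=> x y xB yA; rewrite es; apply: noe.
Qed.

(* Equivalently, at least k vertices lie outside A and B; see k_connectedE. *)
Definition separations_large k e :=
  [forall A, forall B, separation e A B ==> (#|A| + #|B| + k <= #|T|)].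

Lemma separations_largeP k e :
  reflect (forall A B, separation e A B -> #|A| + #|B| + k <= #|T|)
          (separations_large k e).
Proof.
apply: (iffP idP) => [H A B | H].
  by move/forallP: H => /(_ A)/forallP/(_ B)/implyP.
by apply/forallP=> A; apply/forallP=> B; apply/implyP; apply: H.
Qed.

Lemma separations_large_sub k e e' :
  subrel e e' -> separations_large k e -> separations_large k e'.
Proof.
move=> sub /separations_largeP H; apply/separations_largeP => A B.
move=> /separationP[A0 B0 dAB noe]; apply: H; apply/separationP; split=> //.
by move=> x y xA yB; apply: contra (noe x y xA yB); apply: sub.
Qed.

(** The vertices outside [A] and [B] form a cut: a path that avoids them and starts in [A] never
    leaves [A]. Conversely, if deleting [S] disconnects [x] from [y], the component of [x] and the
    remaining vertices outside [S] form a separation. *)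
Lemma k_connectedE k e :
  k_connected k e <-> k < #|T| /\ separations_large k e.
Proof.
split=> -[kT].
- move=> conn; split=> //; apply/separations_largeP => A B sAB.
  case/separationP: (sAB) => /set0Pn[a aA] /set0Pn[b bB] dAB noe.
  have cAB : #|A :|: B| = #|A| + #|B|.
    by apply/eqP; rewrite leq_card_setU; case/and4P: sAB.
  have := cardsC (A :|: B); rewrite cAB => cS.
  case: (ltnP #|~: (A :|: B)| k) => [ltk|]; last by lia.
  have aS : a \notin ~: (A :|: B) by rewrite !inE aA.
  have bS : b \notin ~: (A :|: B) by rewrite !inE bB orbT.
  have /connectP[p pth lst] := conn _ ltk (Sub a aS) (Sub b bS).
  suff : val (last (Sub a aS : {x | x \notin ~: (A :|: B)}) p) \in A.
    by rewrite -lst => /dAB /(_ bB).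
  have : val (Sub a aS : {x | x \notin ~: (A :|: B)}) \in A by [].
  elim: p (Sub a aS) pth {lst} => //= z p IH x /andP[xz pth] xA.
  apply: (IH z) => //; have := valP z; rewrite !inE negbK => /orP[//|zB].
  by move: (noe _ _ xA zB); rewrite [e _ _]xz.
- move=> /separations_largeP H; split=> // S ltS x y; apply: contraT => ncon.
  pose A := [set val z | z in connect (del_vertices e S) x].
  have memA z : (val z \in A) = connect (del_vertices e S) x z.
    by rewrite mem_imset //; exact: val_inj.
  have AS z : z \in A -> z \notin S by case/imsetP=> w _ ->; exact: (valP w).
  have /H : separation e A (~: (A :|: S)).
    apply/separationP; split.
    - by apply/set0Pn; exists (val x); rewrite memA.
    - by apply/set0Pn; exists (val y); rewrite !inE memA (negPf ncon) (negPf (valP y)).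
    - by move=> z zA; rewrite !inE zA.
    - move=> u v /imsetP[z xz ->] {u}; rewrite !inE negb_or => /andP[vA vS].
      apply: contra vA => zv; rewrite -[v]/(val (Sub v vS : {x | x \notin S})) memA.
      by apply: connect_trans xz (connect1 _).
  have dAS : [disjoint A & S].
    by apply/pred0P=> z; apply/negP=> /andP[/AS/negP].
  have cAS : #|A :|: S| = #|A| + #|S|.
    by apply/eqP; rewrite leq_card_setU.
  by have := cardsC (A :|: S); rewrite cAS; lia.
Qed.

(** * Deleting a single edge *)

Lemma set2_inj (x y u v : T) :
  [set x; y] = [set u; v] -> (x = u /\ y = v) \/ (x = v /\ y = u).
Proof.
move=> E; have xE := set21 x y; have yE := set22 x y.
have uE := set21 u v; have vE := set22 u v.
rewrite E in xE yE; rewrite -E in uE vE.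
move: xE yE uE vE => /set2P[]xE /set2P[]yE /set2P[]uE /set2P[]vE.
all: by intuition congruence.
Qed.

Lemma del_edges_sym e F : symmetric e -> symmetric (del_edges e F).
Proof. by move=> es x y; rewrite /del_edges /= es setUC. Qed.

Lemma del_edge_separation e u v C D :
  separation (del_edges e [set [set u; v]]) C D -> ~~ separation e C D ->
  (u \in C) && (v \in D) \/ (v \in C) && (u \in D).
Proof.
move=> /separationP[C0 D0 dCD noe].
rewrite /separation C0 D0; case: (boolP [disjoint C & D]) => [_|/negP[]] /=.
  move=> /forallPn[x]; rewrite negb_imply => /andP[xC /forallPn[y]].
  rewrite negb_imply negbK => /andP[yD exy].
  have := noe x y xC yD; rewrite /del_edges /= exy inE negbK => /eqP/set2_inj.
  by case=> -[<- <-]; rewrite xC yD; auto.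
by apply/pred0P=> x; apply/negP=> /andP[]; apply: dCD.
Qed.

(** This is what allows a separation of the smaller graph to be repaired: dropping [u] from [C] or
    [v] from [D] removes the only crossing edge and leaves a separation of [e], provided the side
    stays nonempty. *)
Lemma del_edge_crossing e u v C D x y :
  separation (del_edges e [set [set u; v]]) C D -> u \in C -> v \in D ->
  x \in C -> y \in D -> e x y -> x = u /\ y = v.
Proof.
move=> /separationP[_ _ dCD noe] uC vD xC yD exy.
have := noe x y xC yD; rewrite /del_edges /= exy inE negbK => /eqP/set2_inj[//|[xv yu]].
by case: (dCD v) => //; rewrite -xv.
Qed.

(** Together with [separations_large k e] the inequality becomes an equality: exactly [k] vertices
    lie outside [A] and [B]. *)
Definition tight_separation k e A B :=
  separation e A B && (#|T| <= #|A| + #|B| + k).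

Definition tight_side k e A := [exists B, tight_separation k e A B].

(* The pairs (A n C, B u D - v) and (B n D, A u C) are both separations of e, and
   the four sizes add up so that if B n D is nonempty then A n C is again a
   tight side, contradicting the minimality of A. *)
Lemma uncross k e A B u v C D :
    symmetric e -> separations_large k e ->
    tight_separation k e A B ->
    (forall A' : {set T}, A' \proper A -> ~~ tight_side k e A') ->
    u \in A -> v \in A ->
    separation (del_edges e [set [set u; v]]) C D ->
    #|T| < #|C| + #|D| + k -> u \in C -> v \in D ->
  B :&: D = set0.
Proof.
move=> es /separations_largeP kc /andP[sAB tAB] minA uA vA sCD tCD uC vD.
apply: contraTeq isT => BD0.
case/separationP: (sAB) => A0 B0 dAB noAB.
case/separationP: (sCD) => C0 D0 dCD _.
have vC : v \notin C by apply/negP=> /dCD; apply.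
have vBD : v \in B :|: D by rewrite inE vD orbT.
(* The deleted edge does no harm here: its end in [D] is [v], which lies in [A] and hence not in
   [B]. *)
have sBD : separation e (B :&: D) (A :|: C).
  apply/separationP; split=> //.
  - by apply/set0Pn; exists u; rewrite inE uA.
  - by move=> x; rewrite !inE => /andP[xB xD] /orP[/dAB|/dCD]; apply.
  - move=> x y; rewrite !inE => /andP[xB xD] /orP[yA|yC].
      by rewrite es; apply: noAB.
    apply/negP; rewrite es => exy.
    have [_ xv] := del_edge_crossing sCD uC vD yC xD exy.
    by apply: (dAB v) => //; rewrite -xv.
have sAC : separation e (A :&: C) ((B :|: D) :\ v).
  apply/separationP; split.
  - by apply/set0Pn; exists u; rewrite inE uA.
  - have /set0Pn[b bB] := B0; apply/set0Pn; exists b; rewrite !inE bB andbT.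
    by apply/eqP=> bv; apply: (dAB b); rewrite // bv.
  - by move=> x; rewrite !inE => /andP[xA xC] /andP[_ /orP[/(dAB x xA)|/(dCD x xC)]].
  - move=> x y; rewrite !inE => /andP[xA xC] /andP[yv /orP[yB|yD]].
      exact: noAB.
    apply: contra yv => exy.
    by have [_ ->] := del_edge_crossing sCD uC vD xC yD exy.
have pAC : A :&: C \proper A.
  by apply/properP; split; [apply: subsetIl | exists v; rewrite // inE (negPf vC) andbF].
have /negP[] := minA _ pAC; apply/existsP; exists ((B :|: D) :\ v).
rewrite /tight_separation sAC /=.
(* The strict inequality assumed for [(C, D)] pays for the removal of [v]. *)
have := kc _ _ sBD; have := cardsD1 v (B :|: D); rewrite vBD.
have := cardsUI A C; have := cardsUI B D; move: tAB tCD; clear.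
move: #|A| #|B| #|C| #|D| #|T| #|A :&: C| #|B :|: D| #|_ :\ v| #|B :&: D|.
move: #|A :|: C|; lia.
Qed.

Lemma degree_separation e A B a :
  irreflexive e -> separation e A B -> a \in A -> degree e a + #|B| < #|T|.
Proof.
move=> eI /separationP[_ _ dAB noe] aA.
have aB : a \notin B by apply/negP=> /(dAB a aA).
have : [set y | e a y] \subset ~: (a |: B).
  apply/subsetP=> y; rewrite !inE => eay; rewrite negb_or.
  apply/andP; split; first by apply: contraTneq eay => ->; rewrite eI.
  by apply: contraL eay; apply: noe.
move=> /subset_leq_card; rewrite -/(degree e a).
have := cardsC (a |: B); rewrite cardsU1 aB.
move: (degree e a) #|~: _| #|B| #|T|; lia.
Qed.

(** Otherwise some [(C, D)] with fewer than [k] vertices outside it is separated by the deletion.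
    Uncrossing, applied once for each orientation of the edge, shows that [B] misses both [C] and
    [D], so [B] has fewer than [k] vertices; the degree condition forbids this. *)
Lemma inner_edge_removable k e A B u v :
    symmetric e -> irreflexive e -> (forall x, 2 * k <= (degree e x).+1) ->
    separations_large k e -> tight_separation k e A B ->
    (forall A' : {set T}, A' \proper A -> ~~ tight_side k e A') ->
    u \in A -> v \in A ->
  separations_large k (del_edges e [set [set u; v]]).
Proof.
move=> es eI deg kc tAB minA.
(* A vertex of [B] has at least 2k - 1 neighbours, all of them among the other vertices of [B] and
   the at most [k] vertices outside [A] and [B]. *)
have cB : k <= #|B|.
  case/andP: (tAB) => sAB; case/separationP: (sAB) => _ /set0Pn[b bB] _ _.
  have := degree_separation eI (separation_sym es sAB) bB; have := deg b.
  move: #|A| #|B| #|T|; lia.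
have main x y C D : x \in A -> y \in A ->
    separation (del_edges e [set [set x; y]]) C D ->
    #|T| < #|C| + #|D| + k -> x \in C -> y \in D -> False.
  move=> xA yA sCD tCD xC yD.
  have sDC : separation (del_edges e [set [set y; x]]) D C.
    by rewrite setUC; apply: separation_sym sCD; apply: del_edges_sym.
  have BD0 := uncross es kc tAB minA xA yA sCD tCD xC yD.
  have tDC : #|T| < #|D| + #|C| + k by rewrite [#|D| + _]addnC.
  have BC0 := uncross es kc tAB minA yA xA sDC tDC yD xC.
  have CD0 : C :&: D = set0.
    by apply/eqP; rewrite setI_eq0; case/and4P: sCD.
  have B0 : B :&: (C :|: D) = set0 by rewrite setIUr BC0 BD0 setU0.
  have := cardsUI C D; have := cardsUI B (C :|: D).
  rewrite CD0 B0 cards0; have := max_card (mem (B :|: (C :|: D))).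
  move: tCD cB; clear.
  move: #|C :|: D| #|_ :|: _| #|B| #|C| #|D| #|T|; lia.
move=> uA vA; apply/separations_largeP=> C D sCD; rewrite leqNgt; apply/negP=> tCD.
case: (boolP (separation e C D)) => [sCDe|nsCD].
  by move/separations_largeP: kc => /(_ _ _ sCDe); rewrite leqNgt tCD.
case: (del_edge_separation sCD nsCD) => /andP[uC vD].
  exact: (main u v C D).
by apply: (main v u C D); rewrite // setUC.
Qed.

Lemma minimal_tight_side k e A B : tight_separation k e A B ->
  exists A' B', [/\ A' \subset A, tight_separation k e A' B'
    & forall A'', A'' \proper A' -> ~~ tight_side k e A''].
Proof.
move=> tAB; have tA : tight_side k e A by apply/existsP; exists B.
have [A' /minsetP[/existsP[B' tA'] minA'] sA'] := minset_exists tA.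
exists A', B'; split=> // A'' /andP[sA'']; apply: contra => tA''.
by rewrite (minA' A'').
Qed.

(** If the deletion created a separation [(C, D)] with fewer than [k] vertices outside, then
    dropping the end of the edge from [C], or from [D], would give a tight separation of [e]. So
    both sides are singletons, which leaves at most k + 1 vertices in all. *)
Lemma edge_removable k e u v :
    k.+1 < #|T| -> separations_large k e -> (forall A, ~~ tight_side k e A) ->
  separations_large k (del_edges e [set [set u; v]]).
Proof.
move=> kT kc ntight.
have ns A B : separation e A B -> #|A| + #|B| + k < #|T|.
  move=> sAB; rewrite ltnNge; apply: contra (ntight A) => tAB.
  by apply/existsP; exists B; rewrite /tight_separation sAB.
have main x y C D : separation (del_edges e [set [set x; y]]) C D ->
    #|T| < #|C| + #|D| + k -> x \in C -> y \in D -> False.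
  move=> sCD tCD xC yD; have cross := del_edge_crossing sCD xC yD.
  case/separationP: sCD => C0 D0 dCD _.
  have cC := cardsD1 x C; have cD := cardsD1 y D; rewrite xC in cC.
  rewrite yD in cD.
  have [C1|C1] := boolP (C :\ x == set0); last first.
    have /ns : separation e (C :\ x) D.
      apply/separationP; split=> // [z|a b].
        by rewrite !inE => /andP[_]; apply: dCD.
      rewrite !inE => /andP[ax aC] bD; apply: contra ax => eab.
      by have [->] := cross a b aC bD eab.
    by move: cC tCD; move: #|C :\ x| #|C| #|D| #|T|; lia.
  have [D1|D1] := boolP (D :\ y == set0); last first.
    have /ns : separation e C (D :\ y).
      apply/separationP; split=> // [z|a b].
        by rewrite !inE => zC /andP[_]; apply: dCD.
      rewrite !inE => aC /andP[yb bD]; apply: contra yb => eab.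
      by have [_ ->] := cross a b aC bD eab.
    by move: cD tCD; move: #|D :\ y| #|C| #|D| #|T|; lia.
  move: cC cD tCD kT; rewrite (eqP C1) (eqP D1) cards0.
  by move: #|C| #|D| #|T|; lia.
apply/separations_largeP=> C D sCD; rewrite leqNgt; apply/negP=> tCD.
case: (boolP (separation e C D)) => [/ns|nsCD].
  by move: tCD; move: #|C| #|D| #|T|; lia.
case: (del_edge_separation sCD nsCD) => /andP[uC vD].
  exact: (main u v C D).
by apply: (main v u C D); rewrite // setUC.
Qed.

(** * Deleting two edges at once *)

Lemma separation_sub e e' A B :
  subrel e' e -> separation e A B -> separation e' A B.
Proof.
move=> sub /separationP[A0 B0 dAB noe]; apply/separationP; split=> // x y xA yB.
by apply: contra (noe x y xA yB); apply: sub.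
Qed.

(** Since neither deletion alone is harmful, both edges must cross a bad separation [(C, D)]. If
    [w1] and [w2] were on the same side, the surviving edge from [w2] to [x] would cross too. If
    they are on opposite sides, every vertex of [X] other than [x] and [y] is adjacent to both and
    so lies outside [C] and [D], where there are fewer than [k] vertices; this contradicts the size
    of [X]. *)
Lemma edge_pair_removable k e (X : {set T}) w1 w2 x y :
    symmetric e -> (forall u v, separations_large k (del_edges e [set [set u; v]])) ->
    w1 != w2 -> x != y -> x \in X -> y \in X -> w1 \notin X -> w2 \notin X ->
    {in X, forall v, e w1 v && e w2 v} -> k.+1 < #|X| ->
  separations_large k (del_edges e [set [set w1; x]; [set w2; y]]).
Proof.
move=> es kc w12 xy xX yX w1X w2X wX kX.
set K := del_edges e _.
have subK2 : subrel (del_edges (del_edges e [set [set w1; x]]) [set [set w2; y]]) K.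
  by move=> a b /andP[/andP[eab]]; rewrite /K /del_edges /= !inE eab negb_or => -> ->.
have subK3 : subrel (del_edges (del_edges e [set [set w2; y]]) [set [set w1; x]]) K.
  move=> a b /andP[/andP[eab]]; rewrite /K /del_edges /= !inE eab negb_or.
  by move=> -> ->.
have symK : symmetric K by apply: del_edges_sym.
have nsep u v C D : #|T| < #|C| + #|D| + k ->
    ~~ separation (del_edges e [set [set u; v]]) C D.
  move=> tCD; apply: contraL tCD; rewrite -leqNgt.
  by have /separations_largeP := kc u v; apply.
have neq w v : w \notin X -> v \in X -> v != w.
  by move=> wX' vX; apply: contraNneq wX' => <-.
have KX1 v : v \in X -> v != x -> K w1 v.
  move=> vX vx; have /andP[e1 _] := wX v vX; rewrite /K /del_edges /= e1 !inE.
  apply/norP; split; apply/eqP => /set2_inj[][E1 E2].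
  - by rewrite E2 eqxx in vx.
  - by move: (neq w1 x w1X xX); rewrite E1 eqxx.
  - by rewrite E1 eqxx in w12.
  - by move: (neq w1 y w1X yX); rewrite E1 eqxx.
have KX2 v : v \in X -> v != y -> K w2 v.
  move=> vX vy; have /andP[_ e2] := wX v vX; rewrite /K /del_edges /= e2 !inE.
  apply/norP; split; apply/eqP => /set2_inj[][E1 E2].
  - by rewrite E1 eqxx in w12.
  - by move: (neq w2 x w2X xX); rewrite E1 eqxx.
  - by rewrite E2 eqxx in vy.
  - by move: (neq w2 y w2X yX); rewrite E1 eqxx.
have main C D : separation K C D -> #|T| < #|C| + #|D| + k ->
    w1 \in C -> x \in D -> False.
  move=> sCD tCD w1C xD; case/separationP: (sCD) => _ _ dCD noe.
  have [] := del_edge_separation (separation_sub subK2 sCD) (nsep w1 x C D tCD).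
    by case/andP=> w2C yD; have /negP[] := noe _ _ w2C xD; apply: KX2.
  case/andP=> yC w2D.
  have : X \subset [set x; y] :|: ~: (C :|: D).
    apply/subsetP=> v vX; rewrite !inE negb_or.
    case: eqVneq => //= vx; case: eqVneq => //= vy; apply/andP; split.
      by apply/negP=> vC; have /negP[] := noe _ _ vC w2D; rewrite symK KX2.
    by apply/negP=> vD; have /negP[] := noe _ _ w1C vD; rewrite KX1.
  move=> /subset_leq_card; have := leq_card_setU [set x; y] (~: (C :|: D)).
  case=> + _; rewrite cards2 xy; have := cardsC (C :|: D).
  have -> : #|C :|: D| = #|C| + #|D|.
    by apply/eqP; rewrite leq_card_setU; case/and4P: sCD.
  move: tCD kX; clear.
  by move: #|_ :|: _| #|~: _| #|C| #|D| #|X| #|T|; lia.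
apply/separations_largeP=> C D sCD; rewrite leqNgt; apply/negP=> tCD.
have [] := del_edge_separation (separation_sub subK3 sCD) (nsep w2 y C D tCD).
  by case/andP=> w1C xD; apply: (main C D).
case/andP=> xC w1D; apply: (main D C) => //; first exact: separation_sym.
by rewrite [#|D| + _]addnC.
Qed.

End Separations.

(** * Matchings and the vertices they cover *)

Section Matchings.

Variables (T : finType) (e : rel T).
Hypotheses (e_sym : symmetric e) (e_irr : irreflexive e).
Implicit Types (M : {set {set T}}).

Lemma edgesP (E : {set T}) :
  reflect (exists x y, e x y /\ E = [set x; y]) (E \in edges e).
Proof.
apply: (iffP imset2P) => [[x y _ + ->]|[x [y [exy ->]]]].
  by rewrite inE => /andP[_ exy]; exists x, y.
by exists x y => //; rewrite inE.
Qed.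

Lemma card_edge E : E \in edges e -> #|E| = 2.
Proof.
case/edgesP=> x [y [exy ->]]; rewrite cards2.
by case: eqVneq exy => // ->; rewrite e_irr.
Qed.

Lemma card_cover_matching M : matching e M -> #|cover M| = 2 * #|M|.
Proof.
case=> /subsetP sM tM; rewrite -(eqP tM) mulnC -sum_nat_const.
by apply: eq_bigr => E /sM /card_edge.
Qed.

Lemma matchingS M M' : M' \subset M -> matching e M -> matching e M'.
Proof. by move=> sM' [sM tM]; split; [apply: subset_trans sM|apply: trivIsetS tM]. Qed.

Lemma matchingU1 M u v : matching e M -> e u v ->
    u \notin cover M -> v \notin cover M ->
  matching e ([set u; v] |: M) /\ #|[set u; v] |: M| = #|M|.+1.
Proof.
move=> [sM tM] euv uM vM.
have M0 : set0 \notin M.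
  by apply/negP => /(subsetP sM)/card_edge; rewrite cards0.
have dM (E : {set T}) : E \in M -> [disjoint [set u; v] & E].
  move=> EM; apply/pred0P=> x; apply/negP=> /andP[/set2P[]-> xE].
    by case/bigcupP: uM; exists E.
  by case/bigcupP: vM; exists E.
have [tM' nM] := trivIsetU1 dM tM M0; split; last by rewrite cardsU1 nM.
split=> //; apply/subsetP=> E /setU1P[->|/(subsetP sM)//].
by apply/edgesP; exists u, v.
Qed.

Lemma coverU1 M (E : {set T}) : cover (E |: M) = E :|: cover M.
Proof. by rewrite /cover bigcup_setU big_set1. Qed.

Lemma cover_rem M (E : {set T}) x :
  trivIset M -> E \in M -> x \in E -> x \notin cover (M :\ E).
Proof.
move=> /trivIsetP tM EM xE; apply/bigcupP=> -[F /setD1P[FE FM] xF].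
by move: (tM F E FM EM FE) => /disjointFr /(_ xF); rewrite xE.
Qed.

Lemma coverS M M' : M' \subset M -> cover M' \subset cover M.
Proof.
move=> sM; apply/subsetP=> x /bigcupP[E EM xE].
by apply/bigcupP; exists E; rewrite // (subsetP sM).
Qed.

(** At most one member of [M] contains [x], and none does if [x] is uncovered. *)
Lemma degree_del_matching M x : trivIset M ->
  degree e x <= degree (del_edges e M) x + (x \in cover M).
Proof.
move=> /trivIsetP tM; set L := [set y | [set x; y] \in M].
have cL : #|L| <= (x \in cover M).
  case: (boolP (x \in cover M)) => [_|xM].
    apply/card_le1_eqP=> y z; rewrite !inE => yM zM.
    case: (eqVneq [set x; y] [set x; z]) => [/set2_inj[][]// -> //|nyz].
    by move: (tM _ _ yM zM nyz) => /disjointFr /(_ (set21 x y)); rewrite set21.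
  rewrite leqn0 cards_eq0; apply: contraR xM => /set0Pn[y]; rewrite inE => yM.
  by apply/bigcupP; exists [set x; y]; rewrite ?set21.
apply: leq_trans (leq_add (leqnn _) cL).
have [+ _] := leq_card_setU [set y | del_edges e M x y] L.
apply: leq_trans; apply: subset_leq_card; apply/subsetP=> y.
by rewrite !inE /del_edges /= => ->; rewrite orNb.
Qed.

(** * Enlarging a removable matching by one edge *)

Variables (k d : nat).
Hypotheses (k_gt0 : 0 < k) (d_large : 2 * k + 1 <= d).
Hypotheses (e_deg : forall x, d <= degree e x) (d_lt_card : d < #|T|).

(** Take an uncovered vertex of [A], if there is one. Its uncovered neighbours cannot lie in [A],
    since the joining edge would be removable by [inner_edge_removable]. So its [d] or more
    neighbours lie in the covered part of [A] or among the [k] vertices outside [A] and [B]. *)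
Lemma cover_minimal_tight_side M A B :
    matching e M -> separations_large k (del_edges e M) ->
    tight_separation k (del_edges e M) A B ->
    (forall A' : {set T}, A' \proper A -> ~~ tight_side k (del_edges e M) A') ->
    (forall u v, u \notin cover M -> v \notin cover M -> e u v ->
       ~~ separations_large k (del_edges (del_edges e M) [set [set u; v]])) ->
  d <= #|A :&: cover M| + k.
Proof.
move=> [sM tM] kc tAB minA noaug.
set H := del_edges e M in kc tAB minA noaug *.
have Hs : symmetric H by apply: del_edges_sym.
have HI : irreflexive H by move=> x; rewrite /H /del_edges /= e_irr.
have Hdeg x : 2 * k <= (degree H x).+1.
  have := degree_del_matching x tM; rewrite -/H.
  by have := e_deg x; move: d_large; case: (_ \in _); lia.
case/andP: (tAB) => sAB cAB; case/separationP: (sAB) => /set0Pn[a0 a0A] _ dAB noe.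
(* When all of [A] is covered, [a0] may lose one neighbour to the matching, but the strict bound of
   [degree_separation], where [a0] is not counted among its own neighbours, makes up for it. *)
have [sAM|/subsetPn[a aA aM]] := boolP (A \subset cover M).
  rewrite (setIidPl sAM).
  have := degree_separation HI sAB a0A.
  have := degree_del_matching a0 tM; rewrite -/H (subsetP sAM _ a0A).
  have := e_deg a0; move: cAB; move: #|A| #|B| #|T|; lia.
have cAB' : #|A :|: B| = #|A| + #|B|.
  by apply/eqP; rewrite leq_card_setU; case/and4P: sAB.
have : [set y | H a y] \subset (A :&: cover M) :|: ~: (A :|: B).
  apply/subsetP=> y; rewrite !inE => ay; rewrite negb_or.
  have -> : y \notin B by apply: contraL ay; apply: noe.
  rewrite andbT; case: (boolP (y \in A)) => //= yA.
  rewrite orbF; apply: contraT => yM; case/andP: ay => eay _.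
  by case/negP: (noaug a y aM yM eay); apply: inner_edge_removable tAB minA _ _.
move=> /subset_leq_card; rewrite -/(degree H a).
have [+ _] := leq_card_setU (A :&: cover M) (~: (A :|: B)).
have := degree_del_matching a tM; rewrite -/H (negPf aM).
have := e_deg a; have := cardsC (A :|: B); rewrite cAB'; move: cAB; clear.
move: #|_ :|: _| #|_ :&: _| #|~: _| (degree e a) (degree H a) #|A| #|B| #|T|; lia.
Qed.

Lemma tight_augment M A B :
    matching e M -> separations_large k (del_edges e M) -> 2 * #|M| <= d ->
    tight_separation k (del_edges e M) A B ->
  exists u v, [/\ u \notin cover M, v \notin cover M, e u v
    & separations_large k (del_edges (del_edges e M) [set [set u; v]])].
Proof.
move=> mM kc cM tAB; set H := del_edges e M.
pose aug u v := [&& u \notin cover M, v \notin cover M, e u v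
    & separations_large k (del_edges H [set [set u; v]])].
have [/existsP[u /existsP[v /and4P[]]]|noaug] := boolP [exists u, exists v, aug u v].
  by exists u, v.
have {}noaug u v : u \notin cover M -> v \notin cover M -> e u v ->
    ~~ separations_large k (del_edges H [set [set u; v]]).
  move=> uM vM euv; apply: contra noaug => kuv.
  by apply/existsP; exists u; apply/existsP; exists v; apply/and4P.
have tBA : tight_separation k H B A.
  case/andP: tAB => sAB cAB; rewrite /tight_separation [#|B| + _]addnC cAB andbT.
  by apply: separation_sym sAB; apply: del_edges_sym.
have [A1 [B1 [sA1 tA1 minA1]]] := minimal_tight_side tAB.
have [A2 [B2 [sA2 tA2 minA2]]] := minimal_tight_side tBA.
have := cover_minimal_tight_side mM kc tA1 minA1 noaug.
have := cover_minimal_tight_side mM kc tA2 minA2 noaug.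
(* [A1] lies in [A] and [A2] in [B], so the two bounds add up to 2(d - k) <= 2|M| <= d, against d >=
   2k + 1. *)
have d12 : (A1 :&: cover M) :&: (A2 :&: cover M) = set0.
  apply/setP=> z; rewrite !inE; apply/negP=> /andP[/andP[z1 _] /andP[z2 _]].
  case/andP: tAB => /separationP[_ _ dAB _] _.
  by apply: (dAB z); [apply: (subsetP sA1)|apply: (subsetP sA2)].
have := cardsUI (A1 :&: cover M) (A2 :&: cover M); rewrite d12 cards0.
have : #|(A1 :&: cover M) :|: (A2 :&: cover M)| <= #|cover M|.
  by apply: subset_leq_card; rewrite subUset !subsetIr.
rewrite (card_cover_matching mM); move: cM d_large; clear.
move: #|_ :|: _| #|A1 :&: _| #|A2 :&: _| #|M|; lia.
Qed.

Lemma augment M :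
    matching e M -> separations_large k (del_edges e M) -> 2 * #|M| <= d ->
    odd d || (#|T| != d.+1) ->
  exists M', [/\ matching e M', #|M'| = #|M|.+1
    & separations_large k (del_edges e M')].
Proof.
move=> mM kc cM exc; set H := del_edges e M.
have add1 u v : u \notin cover M -> v \notin cover M -> e u v ->
    separations_large k (del_edges H [set [set u; v]]) ->
  exists M', [/\ matching e M', #|M'| = #|M|.+1
    & separations_large k (del_edges e M')].
  move=> uM vM euv kuv; have [mM' cM'] := matchingU1 mM euv uM vM.
  exists ([set u; v] |: M); split=> //; apply: separations_large_sub kuv.
  move=> a b /andP[/andP[eab abM]]; rewrite inE => abuv.
  by rewrite /del_edges /= eab !inE negb_or abuv.
have [/existsP[A /existsP[B tAB]]|ntight] := boolP [exists A, tight_side k H A].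
  by have [u [v [uM vM euv kuv]]] := tight_augment mM kc cM tAB; apply: (add1 u v).
have {}ntight A : ~~ tight_side k H A.
  by apply: contra ntight => tA; apply/existsP; exists A.
have kuv u v : separations_large k (del_edges H [set [set u; v]]).
  by apply: edge_removable => //; move: d_large k_gt0 d_lt_card; lia.
have cov := card_cover_matching mM.
have [/existsP[u /existsP[v /and3P[uM vM euv]]]|noaug] :=
  boolP [exists u, exists v, [&& u \notin cover M, v \notin cover M & e u v]].
  exact: (add1 u v).
(* The neighbourhood of an uncovered [w] has at least [d] elements and lies in [cover M], which has
   at most [d]. *)
have nbr w : w \notin cover M -> 2 * #|M| = d /\ [set y | e w y] = cover M.
  move=> wM; have sub : [set y | e w y] \subset cover M.
    apply/subsetP=> y; rewrite inE => ewy; apply: contraR noaug => yM.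
    by apply/existsP; exists w; apply/existsP; exists y; apply/and3P.
  have := subset_leq_card sub; rewrite -/(degree e w) cov => le1.
  have Md : 2 * #|M| = d by have := e_deg w; move: le1 cM; lia.
  by split=> //; apply/eqP; rewrite eqEcard sub cov Md e_deg.
have /subsetPn[w1 _ w1M] : ~~ ([set: T] \subset cover M).
  apply: contraTN isT => /subset_leq_card; rewrite cardsT cov leqNgt.
  by rewrite (leq_ltn_trans cM d_lt_card).
have [Md N1] := nbr w1 w1M.
(* As [d] is even, [exc] excludes d + 1 vertices, so a second uncovered vertex exists besides
   [w1]. *)
have evd : ~~ odd d by rewrite -Md; lia.
rewrite (negPf evd) /= in exc.
have /subsetPn[w2 _ ] : ~~ ([set: T] \subset w1 |: cover M).
  apply: contraTN isT => /subset_leq_card; rewrite cardsT cardsU1 w1M cov Md.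
  by rewrite leqNgt ltn_neqAle eq_sym exc d_lt_card.
rewrite !inE negb_or => /andP[w21 w2M]; have [_ N2] := nbr w2 w2M.
have /set0Pn[E EM] : M != set0.
  by rewrite -card_gt0; move: Md d_large; clear; lia.
case: (mM) => sM tM; have /edgesP[x [y [exy defE]]] := subsetP sM E EM.
have xE : x \in E by rewrite defE set21.
have yE : y \in E by rewrite defE set22.
have xM : x \in cover M by apply/bigcupP; exists E.
have yM : y \in cover M by apply/bigcupP; exists E.
have xy : x != y by apply: contraTneq exy => ->; rewrite e_irr.
have neq w v : w \notin cover M -> v \in cover M -> v != w.
  by move=> wX' vX; apply: contraNneq wX' => <-.
have ew1 v : v \in cover M -> e w1 v by rewrite -N1 inE.
have ew2 v : v \in cover M -> e w2 v by rewrite -N2 inE.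
(* Hence [w1] and [w2] are still adjacent to all of [cover M] after the deletion of [M]. *)
have nM w v : w \notin cover M -> [set w; v] \notin M.
  by apply: contra => wvM; apply/bigcupP; exists [set w; v]; rewrite ?set21.
have sM0 : M :\ E \subset M by apply: subsetDl.
have w1M0 : w1 \notin cover (M :\ E) by apply: contra w1M; apply/subsetP/coverS.
have w2M0 : w2 \notin cover (M :\ E) by apply: contra w2M; apply/subsetP/coverS.
have [m1 c1] := matchingU1 (matchingS sM0 mM) (ew1 x xM) w1M0 (cover_rem tM EM xE).
have w2M1 : w2 \notin cover ([set w1; x] |: (M :\ E)).
  by rewrite coverU1 !inE !negb_or w21 w2M0 eq_sym (neq w2 x w2M xM).
have yM1 : y \notin cover ([set w1; x] |: (M :\ E)).
  by rewrite coverU1 !inE !negb_or (neq w1 y w1M yM) eq_sym xy (cover_rem tM EM yE).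
have [m2 c2] := matchingU1 m1 (ew2 y yM) w2M1 yM1.
exists ([set w2; y] |: ([set w1; x] |: (M :\ E))); split=> //.
  by rewrite c2 c1 (cardsD1 E M) EM.
(* Giving [E] back only adds an edge, so it suffices to delete the two new edges from [H]. The
   common neighbourhood [cover M] has d >= 2k + 1 > k + 1 vertices because k >= 1. *)
have : separations_large k (del_edges H [set [set w1; x]; [set w2; y]]).
  apply: (@edge_pair_removable _ _ _ (cover M)) => //.
  - exact: del_edges_sym.
  - by rewrite eq_sym.
  - by move=> v vM; rewrite /H /del_edges /= ew1 // ew2 // !nM.
  - by rewrite cov Md; move: d_large k_gt0; clear; lia.
apply: separations_large_sub => a b /andP[/andP[eab abM]].
rewrite !inE negb_or => /andP[ab1 ab2].
by rewrite /del_edges /= eab !inE !negb_or ab1 ab2 (negPf abM) andbF.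
Qed.

End Matchings.

(** * Minimum degree, the exceptional complete graph, and the theorem *)

Lemma min_degree_le (T : finType) (e : rel T) x : min_degree e <= degree e x.
Proof.
rewrite /min_degree; have : x \in index_enum T by rewrite mem_index_enum.
elim: (index_enum T) => // y s IH; rewrite big_cons inE.
by case/orP=> [/eqP->|/IH]; [apply: geq_minl|rewrite geq_min => ->; rewrite orbT].
Qed.

Lemma degree_lt_card (T : finType) (e : rel T) x :
  irreflexive e -> degree e x < #|T|.
Proof.
move=> eI; rewrite -cardsT; apply: proper_card; apply/properP.
by split; [apply: subsetT | exists x; rewrite ?inE ?eI].
Qed.

(** A vertex is not its own neighbour, so [n] neighbours among n + 1 vertices are all the others,
    and any enumeration of the vertices is an isomorphism. *)
Lemma complete_graph_iso (T : finType) (e : rel T) n :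
    simple_graph e -> #|T| = n.+1 -> (forall x, n <= degree e x) ->
  graph_iso e (complete_graph n.+1).
Proof.
move=> [es eI] cT deg; exists (cast_ord cT \o enum_rank); split.
  apply: bij_comp; last exact: enum_rank_bij.
  by exists (cast_ord (esym cT)); [apply: cast_ordK|apply: cast_ordKV].
move=> x y; rewrite /complete_graph /= (inj_eq (@cast_ord_inj _ _ _)).
rewrite (inj_eq enum_rank_inj).
have /setP/(_ y) : [set y | e x y] = [set~ x].
  apply/eqP; rewrite eqEcard; apply/andP; split.
    by apply/subsetP=> z; rewrite !inE; apply: contraTneq => ->; rewrite eI.
  by rewrite cardsC1 cT; apply: deg.
by rewrite !inE eq_sym => ->.
Qed.

Theorem corollary1p8 (k : nat) (T : finType) (e : rel T)
  (hk : 1 <= k) (he : simple_graph e) (hconn : k_connected k e)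
  (hdeg : 2 * k + 1 <= min_degree e)
  (hexc : ~ (~~ odd (min_degree e) /\
             graph_iso e (complete_graph (min_degree e).+1))) :
  exists M : {set {set T}},
    l_matching (uphalf (min_degree e).+1) e M /\ k_removable k e M.
Proof.
have [es eI] := he; have [kT kc] := (k_connectedE k e).1 hconn.
have deg := min_degree_le e; set d := min_degree e in hdeg hexc deg *.
have dT : d < #|T|.
  have /card_gt0P[x _] : 0 < #|T| by apply: leq_trans kT.
  exact: leq_ltn_trans (deg x) (degree_lt_card x eI).
have exc : odd d || (#|T| != d.+1).
  apply: contraT; rewrite negb_or negbK => /andP[ev /eqP cT].
  by case: hexc; split=> //; apply: complete_graph_iso.
suff [M [mM cM kM]] : exists M, [/\ matching e M, #|M| = uphalf d.+1
    & separations_large k (del_edges e M)].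
  by exists M; split=> //; apply/k_connectedE.
have : uphalf d.+1 <= uphalf d.+1 by [].
(* Removable matchings of every size up to the target are built by induction, starting from the
   empty one. *)
elim: {-2}(uphalf d.+1) => [_|m IH lem].
  exists set0; split; rewrite ?cards0 //.
    by split; [apply: sub0set | apply/trivIsetP=> A B; rewrite inE].
  by apply: separations_large_sub kc => x y exy; rewrite /del_edges /= exy inE.
have [M [mM cM kM]] := IH (ltnW lem).
have [] := augment es eI hk hdeg deg dT mM kM _ exc.
  (* A size [m] strictly below the rounded-up half of d + 1 satisfies 2m <= d, which is exactly what
     [augment] asks for. *)
  by rewrite cM; move: lem; rewrite uphalfE; clear; lia.
by move=> M' [mM' cM' kM']; exists M'; rewrite cM' cM.
Qed.
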